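(* Let $K$ be a field, $T(H,\alpha)$ a non-commutative torus over $K$, $B\subset T(H,1)(K)=\mathrm{Hom}(H,K^* )$ a period group, and $\mathcal{L}=(h_l,h_r,\psi,(\,,))$ a theta multiplier for $T(H,\alpha)$ and $B$. (a) We have $\dim\Gamma(\mathcal{L})=[H:h^-(B)]$. (b) Assume that $K$ is a normed field. Then all theta functions with multiplier $\mathcal{L}$ are analytic if $[H:h^-(B)]<\infty$ and $$\log\bigl|(b,b)\,\alpha(h_{b,l},-h_{b,r})\bigr|$$ is a positive definite quadratic form on $B$ (as a function of $b\in B$). In particular, assume that $B$ is free and the quantization parameter $\alpha$ is unitary, $|\alpha(h,h')|\equiv1$. Then this condition means that $\mathrm{rk}\,B=\mathrm{rk}\,H$, $B$ is discrete in $T(H,1)(K)$, and $\log|(b,b)|$ is positive definite.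
   Context: $H$ is a free abelian group of finite rank and $\alpha:H\times H\to K^*$ satisfies $\alpha(h,g)=\alpha(g,h)^{-1}$, $\alpha(h_1+h_2,g)=\alpha(h_1,g)\alpha(h_2,g)$. $Al(H,\alpha)$ is the $K$-algebra with basis $e(h)$, $h\in H$, and multiplication $e(h)e(h')=\alpha(h,h')e(h+h')$; it is the ring of algebraic functions of $T(H,\alpha)$. $Af(H,\alpha)$ is the two-sided $Al(H,\alpha)$-module of formal functions, i.e. infinite linear combinations $\sum_{h\in H}a_he(h)$, $a_h\in K$. When $K$ is normed, a formal function $\sum a_he(h)$ is called analytic if for any $N$ one has $|a_h|\,\|h\|^N\to0$ as $\|h\|\to\infty$, where $\|\cdot\|$ is any Euclidean norm on $H$. The period group $B$ is a subgroup of $\mathrm{Hom}(H,K^* )$, written additively. For $b\in B$, $h(b)\in K^*$ denotes the value of $b$ on $h\in H$, and $b^*(\sum a_he(h))=\sum a_hh(b)e(h)$. A theta multiplier $\mathcal{L}=(h_l,h_r,\psi,(\,,))$ for $T(H,\alpha)$ and $B$ consists of group homomorphisms $h_l,h_r:B\to H$ (the images of $b$ are denoted $h_{b,l},h_{b,r}$, and $h^{\pm}=h_l\pm h_r$, with image of $b$ denoted $h^\pm_b$), a group homomorphism $\psi:B\to K^*$, and a symmetric (bimultiplicative) pairing $(\,,):B\times B\to K^*$, such that for all $b_1,b_2\in B$ $$h^-_{b_2}(b_1)=(b_1,b_2)^2\,\alpha(h_{b_1,l},h_{b_2,l})\,\alpha(h_{b_1,r},h_{b_2,r})^{-1}.$$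 A theta function with multiplier $\mathcal{L}$ is a formal function $\theta\in Af(H,\alpha)$ satisfying $$b^*(\theta)=\psi(b)\,(b,b)\,e(h_{b,l})\,\theta\,e(h_{b,r})^{-1}\quad\text{for all }b\in B.$$ The $K$-linear space of these is denoted $\Gamma(\mathcal{L})$.
   Formalization: In (a), h^- is assumed injective (otherwise false); in (b), the form is log|(b,b)α(h_{b,l},-h_{b,r})^{-1}|, as the printed sign of α is false; positive definite means on B⊗R; dimension and index are compared in N∪{∞}. *)

(* Defs.v *)
From HB Require Import structures.
From mathcomp Require Import all_boot all_order all_algebra.
From mathcomp Require Import finmap.
From mathcomp Require Import boolp classical_sets functions cardinality fsbigop.
From mathcomp Require Import reals exp.

Set Implicit Arguments.
Unset Strict Implicit.
Unset Printing Implicit Defensive.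

Import Order.TTheory GRing.Theory Num.Theory.

Local Open Scope classical_set_scope.
Local Open Scope card_scope.
Local Open Scope ring_scope.

Section Dimension.
Context (R : nzRingType) (V : lmodType R).

Definition lin_indep n (v : 'I_n -> V) : Prop :=
  forall c : 'I_n -> R, \sum_(i < n) c i *: v i = 0 -> forall i, c i = 0.

Definition is_basis (W S : set V) : Prop :=
  [/\ S `<=` W,
      forall n (v : 'I_n -> V),
        injective v -> (forall i, S (v i)) -> lin_indep v
    & forall w, W w -> exists n (v : 'I_n -> V) (c : 'I_n -> R),
        (forall i, S (v i)) /\ w = \sum_(i < n) c i *: v i].

(* A dimension or an index is infinite when it is not a natural number n. *)
Definition has_dim (W : set V) (n : nat) : Prop :=
  exists2 S, is_basis W S & S #= `I_n.

End Dimension.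

(* Abelian groups are Z-modules through the library's alias [zmodule]. *)
Definition is_free (G : zmodType) : Prop :=
  exists S, is_basis [set: zmodule G] S.

Definition free_of_rank (G : zmodType) (n : nat) : Prop :=
  has_dim [set: zmodule G] n.

Definition cosets (G : zmodType) (S : set G) : set (set G) :=
  [set [set g + s | s in S] | g in [set: G]].

Definition has_index (G : zmodType) (S : set G) (n : nat) : Prop :=
  cosets S #= `I_n.

Definition finite_index (G : zmodType) (S : set G) : Prop :=
  finite_set (cosets S).

Section PositiveDefinite.
Context (R : realType) (G : zmodType).

(* Twice the symmetric bilinear form of q. *)
Definition polar (q : G -> R) (x y : G) : R := q (x + y) - q x - q y.

Definition quadratic_form (q : G -> R) : Prop :=
  (forall (x : G) (m : int), q (x *~ m) = m%:~R ^+ 2 * q x) /\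
  (forall x y z : G, polar q (x + y) z = polar q x z + polar q y z).

(* Positive definiteness is that of the real quadratic form which q induces on
   the real vector space G (x) R, i.e. of all the Gram matrices of Z-linearly
   independent families.  Requiring only q x > 0 for x <> 0 is strictly weaker:
   it allows (m, n) |-> (m + sqrt 2 * n) ^+ 2 on Z^2. *)
Definition positive_definite (q : G -> R) : Prop :=
  quadratic_form q /\
  forall n (x : 'I_n -> zmodule G), lin_indep x ->
  forall t : 'I_n -> R, (exists i, t i != 0) ->
  0 < \sum_(i < n) \sum_(j < n) t i * t j * polar q (x i) (x j).

Definition euclidean_norm (nu : G -> R) : Prop :=
  exists2 q, positive_definite q & forall g, nu g = Num.sqrt (q g).

End PositiveDefinite.

Section TorusPoints.
Context (H : zmodType) (K : fieldType).

Definition is_character (b : H -> K) : Prop :=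
  (forall h, b h != 0) /\ (forall h g, b (h + g) = b h * b g).

(* The group Hom(H, K^* ) of K-points of the commutative torus T(H, 1), written
   additively. *)
Record torus_points := TorusPoint {
  char_fun :> H -> K;
  char_funP : is_character char_fun }.

HB.instance Definition _ := gen_eqMixin torus_points.
HB.instance Definition _ := gen_choiceMixin torus_points.

Lemma torus_points_ext (b c : torus_points) : b =1 c -> b = c.
Proof.
case: b c => [b bP] [c cP] /= /funext bc; case: _ / bc in cP *.
by congr TorusPoint; exact: Prop_irrelevance.
Qed.

Lemma char0 (b : torus_points) : b 0 = 1.
Proof.
have [b_neq0 bD] := char_funP b.
by apply: (mulfI (b_neq0 0)); rewrite -bD addr0 mulr1.
Qed.

Fact is_character1 : is_character (fun=> 1).
Proof. by split=> *; rewrite ?oner_neq0 ?mulr1. Qed.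

Fact is_characterV (b : torus_points) : is_character (fun h => (b h)^-1).
Proof.
have [b_neq0 bD] := char_funP b.
by split=> [h|h g]; rewrite ?invr_eq0 // bD invfM.
Qed.

Fact is_characterM (b c : torus_points) : is_character (fun h => b h * c h).
Proof.
have [b_neq0 bD] := char_funP b; have [c_neq0 cD] := char_funP c.
by split=> [h|h g]; rewrite ?mulf_neq0 // bD cD mulrACA.
Qed.

Definition torus_zero : torus_points := TorusPoint is_character1.
Definition torus_opp (b : torus_points) : torus_points :=
  TorusPoint (is_characterV b).
Definition torus_add (b c : torus_points) : torus_points :=
  TorusPoint (is_characterM b c).

Fact torus_addA : associative torus_add.
Proof. by move=> b c d; apply: torus_points_ext => h /=; rewrite mulrA. Qed.
Fact torus_addC : commutative torus_add.
Proof. by move=> b c; apply: torus_points_ext => h /=; rewrite mulrC. Qed.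
Fact torus_add0 : left_id torus_zero torus_add.
Proof. by move=> b; apply: torus_points_ext => h /=; rewrite mul1r. Qed.
Fact torus_addN : left_inverse torus_zero torus_opp torus_add.
Proof.
move=> b; apply: torus_points_ext => h /=.
by rewrite mulVf //; have [b_neq0 _] := char_funP b.
Qed.

HB.instance Definition _ := GRing.isZmodule.Build torus_points
  torus_addA torus_addC torus_add0 torus_addN.

End TorusPoints.

Section QuantumTorus.
Context (H : zmodType) (K : fieldType) (alpha : H -> H -> K).

Record quantization_parameter : Prop := QuantizationParameter {
  quant_neq0 : forall h g, alpha h g != 0;
  quant_skew : forall h g, alpha h g = (alpha g h)^-1;
  quantDl : forall h1 h2 g, alpha (h1 + h2) g = alpha h1 g * alpha h2 g }.

(* The formal function \sum_h a_h e(h) is its family of coefficients a; the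
   elements of Al(H, alpha) are the finitely supported ones. *)
Definition formal_function := H -> K^o.

(* The product of Al(H, alpha) and its left and right actions on formal
   functions.  The sum is over the h with a nonzero term, of which there are
   finitely many as soon as a or b is finitely supported. *)
Definition quantum_mul (a b : formal_function) : formal_function :=
  fun g => \sum_(h \in [set: H]) a h * b (g - h) * alpha h (g - h).

Definition e (h : H) : formal_function := fun g => (g == h)%:R.

(* The inverse of e(h) in Al(H, alpha), see [quantum_mul_e_einv]. *)
Definition einv (h : H) : formal_function :=
  fun g => (alpha h (- h))^-1 * e (- h) g.

Lemma quantum_mul_e_left (k : H) (a : formal_function) (g : H) :
  quantum_mul (e k) a g = alpha k (g - k) * a (g - k).
Proof.
rewrite /quantum_mul (fsbigTE [fset k]%fset) /=; last first.
  by move=> h; rewrite inE /e => /negbTE ->; rewrite !mul0r.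
by rewrite big_seq_fset1 /e eqxx mul1r mulrC.
Qed.

Lemma quantum_mul_e_right (a : formal_function) (k g : H) :
  quantum_mul a (e k) g = alpha (g - k) k * a (g - k).
Proof.
rewrite /quantum_mul (fsbigTE [fset (g - k)]%fset) /=; last first.
  move=> h; rewrite inE /e => hgk.
  suff /negbTE -> : g - h != k by rewrite mulr0 mul0r.
  by apply: contra hgk => /eqP <-; rewrite subKr.
by rewrite big_seq_fset1 /e subKr eqxx mulr1 mulrC.
Qed.

Lemma quantum_mul_ee (h k : H) :
  quantum_mul (e h) (e k) = alpha h k *: e (h + k).
Proof.
apply/funext => g; rewrite quantum_mul_e_left /e scalrfctE subr_eq (addrC k).
by case: eqP => [->|_]; rewrite ?(mulr0, scaler0)// addrAC subrr add0r.
Qed.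

Lemma quantum_mul_e_einv (h : H) :
  quantization_parameter ->
  quantum_mul (e h) (einv h) = e 0 /\ quantum_mul (einv h) (e h) = e 0.
Proof.
move=> [alpha_neq0 alphaV alphaDl].
have alpha0l g : alpha 0 g = 1.
  by apply: (mulfI (alpha_neq0 0 g)); rewrite -alphaDl addr0 mulr1.
have alphaNl k g : alpha (- k) g = (alpha k g)^-1.
  apply: (mulfI (alpha_neq0 k g)).
  by rewrite -alphaDl subrr alpha0l mulfV.
have alphaNN k : alpha k (- k) = alpha (- k) k.
  by rewrite [LHS]alphaV !alphaNl invrK; exact: alphaV.
split; apply/funext => g.
  rewrite quantum_mul_e_left /einv /e subr_eq addNr.
  by case: eqP => [->|_]; rewrite ?mulr0// sub0r mulr1 mulfV.
rewrite quantum_mul_e_right /einv /e subr_eq addNr.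
by case: eqP => [->|_]; rewrite ?mulr0// sub0r mulr1 alphaNN mulfV.
Qed.

End QuantumTorus.

Section ThetaMultiplier.
Context (H : zmodType) (K : fieldType) (alpha : H -> H -> K).
Context (P : pred (torus_points H K)) (B : subZmodType P).

(* h(b) *)
Definition period_value (b : B) (h : H) : K := (\val b : torus_points H K) h.

Record theta_multiplier := ThetaMultiplier {
  theta_hl : {additive B -> H};
  theta_hr : {additive B -> H};
  theta_psi : B -> K;
  theta_pairing : B -> B -> K;
  theta_psi_neq0 : forall b, theta_psi b != 0;
  theta_psiD : forall b1 b2,
    theta_psi (b1 + b2) = theta_psi b1 * theta_psi b2;
  theta_pairing_neq0 : forall b1 b2, theta_pairing b1 b2 != 0;
  theta_pairingC : forall b1 b2, theta_pairing b1 b2 = theta_pairing b2 b1;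
  theta_pairingDl : forall b1 b2 b,
    theta_pairing (b1 + b2) b = theta_pairing b1 b * theta_pairing b2 b;
  theta_compat : forall b1 b2,
    period_value b1 (theta_hl b2 - theta_hr b2) =
      theta_pairing b1 b2 ^+ 2 * alpha (theta_hl b1) (theta_hl b2)
        * (alpha (theta_hr b1) (theta_hr b2))^-1 }.

Definition theta_hminus (L : theta_multiplier) (b : B) : H :=
  theta_hl L b - theta_hr L b.

Definition period_action (b : B) (a : formal_function H K) :
    formal_function H K :=
  fun h => a h * period_value b h.

Definition Gamma (L : theta_multiplier) : set (formal_function H K) :=
  [set theta | forall b : B,
    period_action b theta =
      (theta_psi L b * theta_pairing L b b) *:
        quantum_mul alpha (quantum_mul alpha (e K (theta_hl L b)) theta)
          (einv alpha (theta_hr L b))].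

End ThetaMultiplier.

Section NormedField.
Context (R : realType) (K : fieldType).

(* The topology of a normed field is that of a real-valued multiplicative
   absolute value; it is neither assumed complete nor nontrivial. *)
Definition absolute_value (nm : K -> R) : Prop :=
  [/\ forall x, 0 <= nm x,
      forall x, nm x = 0 <-> x = 0,
      forall x y, nm (x * y) = nm x * nm y
    & forall x y, nm (x + y) <= nm x + nm y].

Definition analytic (H : zmodType) (nm : K -> R) (a : formal_function H K) :
    Prop :=
  forall nu : H -> R, euclidean_norm nu -> forall N : nat,
  forall eps : R, 0 < eps -> exists M : R,
  forall h, M < nu h -> nm (a h) * nu h ^+ N < eps.

(* At h = 0 the functional equation of a theta function \sum_h a_h e(h) reads
     a_(h^-_b) = +- a_0 psi(b) alpha(h_(b,l), - h_(b,r)) / (b, b),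
   as h^-_b(b) = +- (b, b)^2.  Hence the decay of the coefficients is governed
   by (b, b) / alpha(h_(b,l), - h_(b,r)) = (b, b) alpha(h_(b,l), h_(b,r)), not
   by (b, b) alpha(h_(b,l), - h_(b,r)): with the latter, positive definiteness
   does not imply analyticity. *)
Definition theta_form (H : zmodType) (alpha : H -> H -> K)
    (P : pred (torus_points H K)) (B : subZmodType P) (nm : K -> R)
    (L : theta_multiplier alpha B) (b : B) : R :=
  ln (nm (theta_pairing L b b / alpha (theta_hl L b) (- theta_hr L b))).

(* Discreteness for the topology of pointwise convergence on Hom(H, K^* ), which
   is the topology of (K^* )^n when H has rank n. *)
Definition discrete_in_torus (H : zmodType) (nm : K -> R)
    (P : pred (torus_points H K)) (B : subZmodType P) : Prop :=
  forall b : B, exists (s : seq H) (eps : R), 0 < eps /\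
  forall c : B,
    (forall h, h \in s -> nm (period_value c h - period_value b h) < eps) ->
    c = b.

End NormedField.

(* Main.v *)
(* Comparing coefficients, theta = \sum_h a_h e(h) is a theta function iff
   a_g = c_b(g) a_(g - h^-_b) for explicit factors c_b(g) in K^*; the condition
   on the multiplier makes c a cocycle, so the coefficients along a coset of
   h^-(B) are determined by any one of them, which can be prescribed freely when
   h^- is injective.  This gives (a).  Taking logarithms along a coset,
     log |a_(g + h^-_b)| = log |a_g| + (additive in b) - theta_form b,
   so that positive definiteness yields Gaussian decay in terms of coordinates
   on a subgroup of B mapped by h^- onto m H.  When alpha is unitary,
   log |h^-_c(b)| is the polar form of theta_form, which gives discreteness, and
   theta_form vanishes on the kernel of h^-, so that h^- preserves rank. *)

From HB Require Import structures.
Require Import Defs.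
From mathcomp Require Import all_boot all_order all_algebra.
From mathcomp Require Import finmap ring lra.
From mathcomp Require Import boolp classical_sets functions cardinality fsbigop.
From mathcomp Require Import reals sequences exp.

Set Implicit Arguments.
Unset Strict Implicit.
Unset Printing Implicit Defensive.

Import Order.TTheory GRing.Theory Num.Theory.

Local Open Scope classical_set_scope.
Local Open Scope card_scope.
Local Open Scope ring_scope.

(** * Bases and dimension *)

Lemma card_eq_ordP T (S : set T) n :
  S #= `I_n <-> exists2 f : 'I_n -> T, injective f & range f = S.
Proof.
split=> [|[f f_inj <-]]; last first.
  apply: card_eq_trans (card_esym card_II).
  by apply: inj_card_eq => x y _ _; exact: f_inj.
rewrite card_eq_sym => /(card_eq_trans (card_esym card_II))/card_bijP[f].
case=> g fK gK; exists (fun i => val (f (SigSub (in_setT i)))).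
  by move=> i j /val_inj/(can_inj fK)/(congr1 val).
apply/seteqP; split=> [_ [i _ <-]|x Sx]; first exact: set_valP.
exists (val (g (SigSub (mem_set Sx)))) => //.
by rewrite (_ : SigSub _ = g (SigSub (mem_set Sx))) ?gK //; exact: val_inj.
Qed.

Lemma infinite_set_ord T (A : set T) k : infinite_set A ->
  exists2 f : 'I_k -> T, injective f & forall i, A (f i).
Proof.
move=> /infiniteP/card_leP[f].
exists (fun i : 'I_k => val (f (SigSub (in_setT (i : nat))))).
  move=> i j /val_inj fij; apply: val_inj.
  by have /(congr1 val) : _ := inj (in_setT _) (in_setT _) fij.
by move=> i; exact: set_valP.
Qed.

(** Fraction-free Gaussian elimination, valid over the integers as well as over a field: a nonzero
    pivot in the first column eliminates that column and one row, and a zero column is simply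
    dropped. *)
Lemma idomain_dependent_rows (R : idomainType) d k (A : 'I_k -> 'I_d -> R) :
  (d < k)%N -> exists u : 'I_k -> R,
    (exists i, u i != 0) /\ forall j, \sum_i u i * A i j = 0.
Proof.
elim: d k A => [|d IHd] k A.
  case: k A => // k A _; exists (fun=> 1); split=> [|[]//].
  by exists ord0; exact: oner_neq0.
case: k A => // k A; rewrite ltnS => dk.
have [A0|] := boolP [forall i, A i ord0 == 0].
  have [u [u_neq0 uA]] := IHd _ (fun i j => A i (lift ord0 j)) (leqW dk).
  exists u; split=> // j; case: (unliftP ord0 j) => [j' ->|->] //.
  by rewrite big1 // => i _; rewrite (eqP (forallP A0 i)) mulr0.
rewrite negb_forall => /existsP[i0 p_neq0]; set p := A i0 ord0 in p_neq0.
have [u [[i ui_neq0] uA]] := IHd _ (fun i j =>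
  p * A (lift i0 i) (lift ord0 j) - A (lift i0 i) ord0 * A i0 (lift ord0 j)) dk.
(* The other rows are rescaled by the pivot [p], and the weight of row [i0] is the one that cancels
   column [ord0]. *)
exists (fun i => if unlift i0 i is Some i' then p * u i'
                 else - \sum_i' u i' * A (lift i0 i') ord0); split.
  by exists (lift i0 i); rewrite liftK mulf_neq0.
move=> j; rewrite (bigD1_ord i0) //= unlift_none mulNr mulr_suml.
under [X in _ + X]eq_bigr => i' _ do rewrite liftK.
apply/eqP; rewrite addrC subr_eq0; apply/eqP.
case: (unliftP ord0 j) => [j' ->|->].
  apply/eqP; rewrite -subr_eq0 -sumrB -[X in _ == X](uA j'); apply/eqP.
  by apply: eq_bigr => i' _; ring.
by apply: eq_bigr => i' _; rewrite -/p; ring.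
Qed.

Lemma lin_indep_inj (R : nzRingType) (V : lmodType R) n (v : 'I_n -> V) :
  lin_indep v -> injective v.
Proof.
move=> v_ind i j vij; apply: contrapT => /eqP ij.
have /(v_ind _)/(_ i)/eqP :
    \sum_(k < n) ((k == i)%:R - (k == j)%:R : R) *: v k = 0.
  rewrite (bigD1 i) //= (bigD1 j) 1?eq_sym //= !eqxx [j == i]eq_sym.
  rewrite (negbTE ij) subr0 sub0r scale1r scaleN1r vij addrA subrr add0r.
  by rewrite big1 // => k /andP[/negbTE-> /negbTE->]; rewrite subr0 scale0r.
by rewrite eqxx (negbTE ij) subr0 oner_eq0.
Qed.

Lemma lin_indep_comp (R : nzRingType) (V : lmodType R) m n (v : 'I_n -> V)
    (f : 'I_m -> 'I_n) :
  injective f -> lin_indep v -> lin_indep (v \o f).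
Proof.
move=> f_inj v_ind c cv0 i.
have /v_ind/(_ (f i)) : \sum_j (\sum_(k | f k == j) c k) *: v j = 0.
  rewrite -[RHS]cv0 (partition_big f xpredT) //=; apply: eq_bigr => j _.
  by rewrite scaler_suml; apply: eq_bigr => k /eqP <-.
by rewrite (eq_bigl (pred1 i)) ?big_pred1_eq // => k; rewrite /= (inj_eq f_inj).
Qed.

(** Replaces a basis given as a set by a family indexed by ['I_n], the form suited to
    coordinates. *)
Lemma has_dimP (R : nzRingType) (V : lmodType R) (W : set V) n :
  has_dim W n <-> exists v : 'I_n -> V,
    [/\ forall i, W (v i), lin_indep v
      & forall w, W w -> exists c : 'I_n -> R, w = \sum_i c i *: v i].
Proof.
split=> [[S [SW S_ind S_gen] /card_eq_ordP[v v_inj vS]]|[v [vW v_ind v_gen]]].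
  have Sv i : S (v i) by rewrite -vS; exists i.
  exists v; split=> [i||w /S_gen[m [x [c [Sx ->]]]]]; first exact: SW.
    exact: S_ind.
  have /choice[f fE] : forall i, exists j, v j = x i.
    by move=> i; have := Sx i; rewrite -vS => -[j _ <-]; exists j.
  exists (fun j => \sum_(k | f k == j) c k).
  rewrite (partition_big f xpredT) //=; apply: eq_bigr => j _.
  by rewrite scaler_suml; apply: eq_bigr => k /eqP <-; rewrite fE.
exists (range v); last first.
  by apply/card_eq_ordP; exists v => //; exact: lin_indep_inj.
split=> [_ [i _ <-] //|m x x_inj xv|w /v_gen[c ->]]; last first.
  by exists n, v, c; split=> // i; exists i.
have /choice[f fE] : forall i, exists j, v j = x i.
  by move=> i; have [j _ <-] := xv i; exists j.
have -> : x = v \o f by apply/funext => i; rewrite /= fE.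
by apply: lin_indep_comp => // i j fij; apply: x_inj; rewrite -!fE fij.
Qed.

(** The coordinates of more than [d] vectors in a basis of size [d] form linearly dependent rows. *)
Lemma lin_indep_leq_dim (R : idomainType) (V : lmodType R) (W : set V) k d
    (v : 'I_k -> V) :
  has_dim W d -> (forall i, W (v i)) -> lin_indep v -> (k <= d)%N.
Proof.
move=> /has_dimP[w [_ _ w_gen]] vW v_ind; rewrite leqNgt; apply/negP => dk.
have /choice[A vE] := fun i => w_gen _ (vW i).
have [u [[i ui_neq0] uA]] := idomain_dependent_rows A dk.
case/negP: ui_neq0; apply/eqP; apply: v_ind.
under eq_bigr => j _ do rewrite vE scaler_sumr.
rewrite exchange_big big1 //= => j _.
under eq_bigr => l _ do rewrite scalerA.
by rewrite -scaler_suml uA scale0r.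
Qed.

Lemma has_dim_uniq (R : idomainType) (V : lmodType R) (W : set V) m n :
  has_dim W m -> has_dim W n -> m = n.
Proof.
move=> Wm Wn; have [v [vW v_ind _]] := (has_dimP W m).1 Wm.
have [w [wW w_ind _]] := (has_dimP W n).1 Wn.
apply/anti_leq; apply/andP; split; first exact: (lin_indep_leq_dim Wn vW).
exact: (lin_indep_leq_dim Wm wW).
Qed.

(** * The functional equation on coefficients *)

Lemma cosets_eqP (G H : zmodType) (f : {additive G -> H}) (g h : H) :
  [set g + s | s in range f] = [set h + s | s in range f] <->
  exists b, g = h + f b.
Proof.
split=> [gh|[b ->]].
  have gP : [set g + s | s in range f] g.
    by exists 0; [exists 0; rewrite ?raddf0|rewrite addr0].
  by move: gP; rewrite gh => -[_ [b _ <-] <-]; exists b.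
apply/seteqP; split=> _ [_ [c _ <-] <-].
  by exists (f (b + c)); [exists (b + c)|rewrite raddfD addrA].
by exists (f (c - b)); [exists (c - b)|rewrite raddfB addrACA subrr addr0].
Qed.

Section Multiplier.
Context (H : zmodType) (K : fieldType) (alpha : H -> H -> K).
Hypothesis alphaP : quantization_parameter alpha.

Lemma quantDr h g1 g2 : alpha h (g1 + g2) = alpha h g1 * alpha h g2.
Proof.
rewrite (quant_skew alphaP h (_ + _)) (quantDl alphaP).
by rewrite invfM -!(quant_skew alphaP).
Qed.

Lemma quantNl h g : alpha (- h) g = (alpha h g)^-1.
Proof.
have neq0 := quant_neq0 alphaP; apply: (mulfI (neq0 h g)).
rewrite -quantDl // subrr mulfV //.
by apply: (mulfI (neq0 0 g)); rewrite -quantDl // addr0 mulr1.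
Qed.

Lemma quantNr h g : alpha h (- g) = (alpha h g)^-1.
Proof. by rewrite (quant_skew alphaP h) quantNl -(quant_skew alphaP). Qed.

(** Only the index [g + h] contributes, with the factor alpha(g + h, -h) / alpha(h, -h) = alpha(g,
    -h) = alpha(h, g). *)
Lemma quantum_mul_einv_right (a : formal_function H K) (h g : H) :
  quantum_mul alpha a (einv alpha h) g = alpha h g * a (g + h).
Proof.
rewrite /quantum_mul (fsbigTE [fset (g + h)%R]%fset) /=; last first.
  move=> k; rewrite inE /einv /e => kgh.
  suff /negbTE -> : g - k != - h by rewrite mulr0 mulr0 mul0r.
  by rewrite subr_eq addrC -subr_eq opprK eq_sym.
rewrite big_seq_fset1 /einv /e opprD addNKr eqxx mulr1 -mulrA mulrC.
congr (_ * _); rewrite quantDl // mulrCA mulVf ?(quant_neq0 alphaP) // mulr1.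
by rewrite quantNr -(quant_skew alphaP).
Qed.

Context (P : pred (torus_points H K)) (B : subZmodType P).
Implicit Types (b : B) (g : H).

Lemma period_value_neq0 b g : period_value b g != 0.
Proof. exact: (char_funP (\val b : torus_points H K)).1. Qed.

Lemma period_valueDr b g1 g2 :
  period_value b (g1 + g2) = period_value b g1 * period_value b g2.
Proof. exact: (char_funP (\val b : torus_points H K)).2. Qed.

Lemma period_valueDl b1 b2 g :
  period_value (b1 + b2) g = period_value b1 g * period_value b2 g.
Proof. by rewrite /period_value raddfD. Qed.

Lemma period_valueNr b g : period_value b (- g) = (period_value b g)^-1.
Proof.
apply: (mulfI (period_value_neq0 b g)).
by rewrite -period_valueDr subrr mulfV ?period_value_neq0 // /period_value char0.
Qed.

Variable L : theta_multiplier alpha B.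
Local Notation hl := (theta_hl L).
Local Notation hr := (theta_hr L).

Fact theta_hminus_is_zmod_morphism : zmod_morphism (theta_hminus L).
Proof.
move=> b c; rewrite /theta_hminus (raddfB hl) (raddfB hr) !opprB.
by rewrite addrACA [RHS]addrACA [- hr b + _]addrC.
Qed.

HB.instance Definition _ :=
  GRing.isZmodMorphism.Build B H (theta_hminus L) theta_hminus_is_zmod_morphism.

(** The cocycle c_b(g): multiplication by e(h_(b,l)) on the left and by the inverse of e(h_(b,r)) on
    the right shifts indices by h^-_b and produces these values of alpha. *)
Definition theta_factor b g : K :=
  theta_psi L b * theta_pairing L b b * alpha (hl b + hr b) g
    * alpha (hl b) (hr b - hl b) / period_value b g.

Lemma GammaP (a : formal_function H K) :
  Gamma L a <-> forall b g, a g = theta_factor b g * a (g - theta_hminus L b).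
Proof.
have rhsE b g : ((theta_psi L b * theta_pairing L b b) *:
    quantum_mul alpha (quantum_mul alpha (e K (hl b)) a)
      (einv alpha (hr b))) g
  = theta_factor b g * a (g - theta_hminus L b) * period_value b g.
  rewrite scalrfctE quantum_mul_einv_right quantum_mul_e_left /theta_factor.
  rewrite mulrAC divfK ?period_value_neq0 // opprB.
  rewrite (quantDl alphaP) -addrA quantDr /GRing.scale /=.
  by ring.
split=> [aG b g|aE b].
  by apply: (mulIf (period_value_neq0 b g)); rewrite -rhsE -aG.
by apply/funext => g; rewrite rhsE -aE.
Qed.

Lemma theta_factor_neq0 b g : theta_factor b g != 0.
Proof.
rewrite /theta_factor !mulf_neq0 ?invr_eq0 ?period_value_neq0 //;
  by rewrite ?theta_psi_neq0 ?theta_pairing_neq0 ?(quant_neq0 alphaP).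
Qed.

(* The compatibility condition on the multiplier is the consistency of the
   functional equations for b1, b2 and b1 + b2. *)
Lemma theta_factorD b1 b2 g :
  theta_factor (b1 + b2) g =
    theta_factor b1 g * theta_factor b2 (g - theta_hminus L b1).
Proof.
rewrite /theta_factor theta_psiD !theta_pairingDl.
rewrite ![theta_pairing L _ (b1 + b2)]theta_pairingC !theta_pairingDl.
rewrite (raddfD hl) (raddfD hr) period_valueDl.
rewrite [period_value b2 (g - _)]period_valueDr period_valueNr.
(* The shift by h^-_(b1) brings in b2(h^-_(b1)), whose square (b1, b2)^2 matches the cross terms of
   (b1 + b2, b1 + b2); skew-symmetry of alpha settles the rest. *)
rewrite [period_value b2 (theta_hminus L b1)]theta_compat.
rewrite [theta_pairing L b2 b1]theta_pairingC /theta_hminus.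
rewrite !(quantDl alphaP, quantDr, quantNl, quantNr).
rewrite (quant_skew alphaP (hl b2) (hl b1)) (quant_skew alphaP (hr b2) (hr b1)).
rewrite (quant_skew alphaP (hr b2) (hl b1)).
field.
rewrite ?theta_psi_neq0 ?theta_pairing_neq0 ?period_value_neq0.
by rewrite oner_neq0 !(quant_neq0 alphaP).
Qed.

End Multiplier.

(** * The dimension of the space of theta functions *)

Section Dimension.
Context (H : zmodType) (K : fieldType) (alpha : H -> H -> K).
Hypothesis alphaP : quantization_parameter alpha.
Context (P : pred (torus_points H K)) (B : subZmodType P).
Variable L : theta_multiplier alpha B.
Hypothesis hminus_inj : injective (theta_hminus L).
Local Notation hm := (theta_hminus L).

(** The theta function supported on the coset of [x] and equal to 1 at [x]. The period is picked by
    [cid]; injectivity of h^- makes it unique. *)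
Definition theta_at (x : H) : formal_function H K := fun g =>
  if pselect (exists b, g = x + hm b) is left gx
  then theta_factor L (projT1 (cid gx)) g else 0.

Lemma theta_atE x b : theta_at x (x + hm b) = theta_factor L b (x + hm b).
Proof.
rewrite /theta_at; case: pselect => [gx|[]]; last by exists b.
by case: cid => c /= /addrI/hminus_inj <-.
Qed.

Lemma theta_at_out x g : (forall b, g <> x + hm b) -> theta_at x g = 0.
Proof.
by move=> gx; rewrite /theta_at; case: pselect => // -[b gb]; case: (gx b).
Qed.

Lemma theta_factor0 g : theta_factor L 0 g = 1.
Proof.
apply: (mulfI (theta_factor_neq0 alphaP L 0 g)).
by rewrite mulr1 -[in RHS](addr0 0) theta_factorD // raddf0 subr0.
Qed.

Lemma theta_at_id x : theta_at x x = 1.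
Proof.
by have := theta_atE x 0; rewrite raddf0 addr0 theta_factor0.
Qed.

(** On the coset the functional equation is the cocycle identity for c = b + (c - b); off the coset
    both sides vanish, since [g] and g - h^-_b lie in the same coset. *)
Lemma Gamma_theta_at x : Gamma L (theta_at x).
Proof.
apply/GammaP => // b g; have [[c ->]|gx] := pselect (exists c, g = x + hm c).
  have := theta_factorD alphaP L b (c - b) (x + hm c).
  by rewrite addrC subrK theta_atE => ->; rewrite -addrA -raddfB theta_atE.
rewrite !theta_at_out ?mulr0 // => c gxc; apply: gx.
  by exists (b + c); rewrite raddfD [hm b + _]addrC addrA -gxc subrK.
by exists c.
Qed.

Section Transversal.
Context (d : nat) (x : 'I_d -> H).
Hypothesis x_inj : forall i j b, x i = x j + hm b -> i = j.

Lemma theta_at_transversal i j : theta_at (x i) (x j) = (i == j)%:R.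
Proof.
have [->|ij] := eqVneq i j; first exact: theta_at_id.
by rewrite theta_at_out // => b /x_inj ji; rewrite ji eqxx in ij.
Qed.

(** Evaluation at the representatives is dual to the family [theta_at (x i)], which makes that
    family independent. *)
Lemma sum_theta_at (c : 'I_d -> K) j :
  (\sum_i c i *: theta_at (x i)) (x j) = c j.
Proof.
rewrite fct_sumE (bigD1 j) //= big1 ?addr0 => [|i ij].
  by rewrite scalrfctE theta_at_id /GRing.scale /= mulr1.
by rewrite scalrfctE theta_at_transversal (negbTE ij) scaler0.
Qed.

Lemma theta_at_indep : lin_indep (fun i => theta_at (x i)).
Proof. by move=> c c0 i; rewrite -(sum_theta_at c) c0. Qed.

(** A theta function is determined on each coset by its value at the representative, so its
    coordinates are the [a (x i)]. *)
Lemma has_dim_Gamma_transversal :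
  (forall g, exists i b, g = x i + hm b) -> has_dim (Gamma L) d.
Proof.
move=> x_cover; apply/has_dimP; exists (fun i => theta_at (x i)).
split=> [i||a aG]; [exact: Gamma_theta_at|exact: theta_at_indep|].
exists (fun i => a (x i)); apply/funext => g; have [i [b ->]] := x_cover g.
have /(GammaP alphaP)/(_ b) aE := aG; rewrite aE addrK.
rewrite fct_sumE (bigD1 i) //= big1 ?addr0 => [|j ji].
  by rewrite scalrfctE theta_atE /GRing.scale /= mulrC.
rewrite scalrfctE theta_at_out ?scaler0 // => c.
move=> /(canRL (addrK _)); rewrite -addrA -raddfB => /x_inj ij.
by rewrite ij eqxx in ji.
Qed.

End Transversal.

Lemma cosets_transversal d (f : 'I_d -> set H) :
  injective f -> (forall i, cosets (range hm) (f i)) ->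
  exists2 x : 'I_d -> H, (forall i j b, x i = x j + hm b -> i = j)
    & forall i, f i = [set x i + s | s in range hm].
Proof.
move=> f_inj fC; have /choice[x xE] : forall i, exists x,
    f i = [set x + s | s in range hm].
  by move=> i; have [x _ <-] := fC i; exists x.
exists x => // i j b xij; apply: f_inj; rewrite !xE.
by apply/cosets_eqP; exists b.
Qed.

Lemma has_index_dim_Gamma d : has_index (range hm) d -> has_dim (Gamma L) d.
Proof.
move=> /card_eq_ordP[f f_inj f_range].
have [i|x x_inj fE] := @cosets_transversal _ f f_inj.
  by rewrite -f_range; exists i.
apply: (has_dim_Gamma_transversal x_inj) => g.
have : cosets (range hm) [set g + s | s in range hm] by exists g.
rewrite -f_range => -[i _]; rewrite fE => /esym/cosets_eqP[b gE].
by exists i, b.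
Qed.

Lemma has_dim_Gamma d : has_dim (Gamma L) d <-> has_index (range hm) d.
Proof.
split=> [dimG|]; last exact: has_index_dim_Gamma.
have : finite_set (cosets (range hm)).
  (* Infinitely many cosets would yield [d.+1] independent theta functions in a space of dimension
     [d]. *)
  apply: contrapT => /(@infinite_set_ord _ _ d.+1)[f f_inj fC].
  have [x x_inj _] := cosets_transversal f_inj fC.
  have := lin_indep_leq_dim dimG (fun i => Gamma_theta_at (x i)).
  by move=> /(_ (theta_at_indep x_inj)); rewrite ltnn.
move=> /finite_setP[d' index_d'].
suff -> : d = d' by [].
exact: has_dim_uniq dimG (has_index_dim_Gamma index_d').
Qed.

End Dimension.

(** * Subgroups of finite index *)

(** Pigeonhole: among the [d.+1] multiples 0, h, ..., d h, two lie in the same of the [d] cosets,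
    and their difference lies in the image. *)
Lemma finite_index_exponent (G H : zmodType) (f : {additive G -> H}) (h : H) :
  finite_index (range f) -> exists m, exists b, f b = h *+ m.+1.
Proof.
move=> /finite_setP[d /card_eq_ordP[c c_inj c_range]].
have /choice[idx idxE] : forall k : 'I_d.+1, exists i,
    c i = [set h *+ k + s | s in range f].
  move=> k; have : cosets (range f) [set h *+ k + s | s in range f].
    by exists (h *+ k).
  by rewrite -c_range => -[i _ <-]; exists i.
have [i [j [ij idx_ij]]] : exists i j : 'I_d.+1, (i < j)%N /\ idx i = idx j.
  apply: contrapT => no_ij.
  suff /leq_card : injective idx by rewrite !card_ord ltnn.
  move=> i j idx_ij; apply: contrapT => /eqP; rewrite neq_ltn => /orP[] ltij.
    by apply: no_ij; exists i, j.
  by apply: no_ij; exists j, i.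
have : [set h *+ j + s | s in range f] = [set h *+ i + s | s in range f].
  by rewrite -!idxE idx_ij.
move=> /cosets_eqP[b /(canLR (addKr _)) hb].
exists (j - i).-1, b; rewrite prednK ?subn_gt0 // mulrnBr ?(ltnW ij) // addrC.
exact/esym.
Qed.

Lemma common_exponent (G H : zmodType) (f : {additive G -> H}) n
    (h : 'I_n -> H) :
  (forall i, exists m, exists b, f b = h i *+ m.+1) ->
  exists m, forall i, exists b, f b = h i *+ m.+1.
Proof.
move=> /choice[m mP]; exists (\prod_i (m i).+1).-1 => i.
rewrite prednK ?prodn_gt0 // (bigD1 i) //= mulrnA; have [b <-] := mP i.
by exists (b *+ \prod_(j | j != i) (m j).+1); rewrite raddfMn.
Qed.

(** Euclidean division of each coordinate by [m.+1]: the remainders range over a finite set and the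
    quotients are absorbed by the image of [f]. *)
Lemma coset_decomposition (G H : zmodType) (f : {additive G -> H}) n m
    (h : 'I_n -> H) (b : 'I_n -> G) (k : 'I_n -> int) :
  (forall i, f (b i) = h i *+ m.+1) ->
  exists (r : {ffun 'I_n -> 'I_m.+1}) (l : 'I_n -> int),
    \sum_i h i *~ k i = \sum_i h i *+ r i + f (\sum_i b i *~ l i).
Proof.
move=> fb; have m_neq0 : m.+1%:Z != 0 by [].
have r_lt i : (`|(k i %% m.+1)%Z| < m.+1)%N.
  by rewrite -ltz_nat gez0_abs ?modz_ge0 // ltz_pmod.
exists [ffun i => Ordinal (r_lt i)], (fun i => (k i %/ m.+1)%Z).
rewrite raddf_sum -big_split; apply: eq_bigr => i _ /=.
rewrite ffunE /= raddfMz fb 2!pmulrn -mulrzA -mulrzDr.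
by rewrite gez0_abs ?modz_ge0 // addrC mulrC -divz_eq.
Qed.

Lemma exponent_finite_index (G H : zmodType) (f : {additive G -> H}) n
    (h : 'I_n -> H) :
  (forall g, exists k : 'I_n -> int, g = \sum_i h i *~ k i) ->
  (forall i, exists m, exists b, f b = h i *+ m.+1) ->
  finite_index (range f).
Proof.
move=> h_gen /common_exponent[m /choice[b fb]].
pose F (r : {ffun 'I_n -> 'I_m.+1}) := [set \sum_i h i *+ r i + s | s in range f].
apply: (@sub_finite_set _ _ (range F)); last first.
  by apply: finite_image; exact: finite_finset.
move=> _ [g _ <-]; have [k ->] := h_gen g.
have [r [l ->]] := coset_decomposition k fb; exists r => //.
by apply/esym/cosets_eqP; exists (\sum_i b i *~ l i).
Qed.

Lemma lin_indep_multiple (G H : zmodType) (f : {additive G -> H}) n m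
    (h : 'I_n -> zmodule H) (b : 'I_n -> zmodule G) :
  lin_indep h -> (forall i, f (b i) = h i *+ m.+1) -> lin_indep b.
Proof.
move=> h_ind fb k k0 i; have /h_ind/(_ i)/eqP :
    \sum_j (m.+1%:Z * k j) *: h j = 0.
  rewrite -[RHS](raddf0 f) -[X in _ = f X]k0 raddf_sum.
  by apply: eq_bigr => j _; rewrite [RHS]raddfMz fb scalezrE mulrzA -pmulrn.
by rewrite mulf_eq0 => /eqP.
Qed.

(** Adding a generator [h i] to the [n] independent vectors [v] creates a relation in rank [n]. The
    coefficient of [h i] is nonzero, so a multiple of [h i] lies in the image. *)
Lemma full_rank_finite_index (G H : zmodType) (f : {additive G -> H}) n
    (v : 'I_n -> zmodule H) :
  free_of_rank H n -> lin_indep v -> (forall i, range f (v i)) ->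
  finite_index (range f).
Proof.
move=> H_free v_ind vf; have [h [_ _ h_gen]] := (has_dimP _ _).1 H_free.
apply: (@exponent_finite_index _ _ _ _ h) => [g|i].
  exact: h_gen.
pose w (j : 'I_n.+1) := if unlift ord0 j is Some j' then v j' else h i.
have [k k0 [j kj_neq0]] : exists2 k : 'I_n.+1 -> int,
    \sum_j k j *: w j = 0 & exists j, k j != 0.
  apply: contrapT => no_k; have : lin_indep w.
    move=> k k0 j; apply: contrapT => /eqP kj; apply: no_k.
    by exists k => //; exists j.
  move=> w_ind; suff : (n < n)%N by rewrite ltnn.
  exact: (lin_indep_leq_dim (v := w) H_free).
have {k0} : k ord0 *: h i + \sum_j k (lift ord0 j) *: v j = 0.
  rewrite -[RHS]k0 big_ord_recl /w unlift_none; congr (_ + _).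
  by apply: eq_bigr => j' _; rewrite liftK.
have [k00|k0_neq0] := eqVneq (k ord0) 0.
  rewrite k00 scale0r add0r => /v_ind k0.
  by case: (unliftP ord0 j) kj_neq0 => [j' ->|->]; rewrite ?k0 ?k00.
have /choice[b fb] : forall j, exists b, f b = v j.
  by move=> j'; have [b _ <-] := vf j'; exists b.
have -> : \sum_j k (lift ord0 j) *: v j = f (\sum_j b j *~ k (lift ord0 j)).
  by rewrite raddf_sum; apply: eq_bigr => j' _; rewrite raddfMz fb.
set c := \sum_j _; rewrite scalezrE => /eqP; rewrite addr_eq0 => /eqP.
(* The sign of the coefficient decides whether [- c] or [c] is the preimage of a positive
   multiple. *)
case: (k ord0) k0_neq0 => [[//|m]|m] _ hE; exists m.
  by exists (- c); rewrite raddfN -hE.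
by exists c; apply: oppr_inj; rewrite -hE.
Qed.

(** * Positive definite quadratic forms *)

Section QuadraticForm.
Context (R : realType).

Lemma additive_sumz (G : zmodType) (f : G -> R) n (x : 'I_n -> G)
    (k : 'I_n -> int) :
  (forall x y, f (x + y) = f x + f y) ->
  f (\sum_i x i *~ k i) = \sum_i (k i)%:~R * f (x i).
Proof.
move=> fD; have fB : zmod_morphism f.
  by move=> y z; apply: (addIr (f z)); rewrite -fD !subrK.
pose fA : {additive G -> R} := HB.pack f (GRing.isZmodMorphism.Build G R f fB).
rewrite -[f]/(fA : G -> R) raddf_sum; apply: eq_bigr => i _.
by rewrite raddfMz mulrzl.
Qed.

Lemma polarC (G : zmodType) (q : G -> R) x y : polar q x y = polar q y x.
Proof. by rewrite /polar [y + x]addrC addrAC. Qed.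

Lemma polar_diag (G : zmodType) (q : G -> R) x :
  quadratic_form q -> polar q x x = 2 * q x.
Proof.
move=> [qM _]; have := qM x 2%:Z; rewrite -pmulrn mulr2n /polar => ->.
by ring.
Qed.

Lemma polar_sumzl (G : zmodType) (q : G -> R) n (x : 'I_n -> G)
    (k : 'I_n -> int) y :
  quadratic_form q ->
  polar q (\sum_i x i *~ k i) y = \sum_i (k i)%:~R * polar q (x i) y.
Proof.
by move=> [_ qD]; apply: (@additive_sumz _ (polar q ^~ y)) => z t; exact: qD.
Qed.

Lemma polar_sumz (G : zmodType) (q : G -> R) n (x : 'I_n -> G)
    (k l : 'I_n -> int) :
  quadratic_form q ->
  polar q (\sum_i x i *~ k i) (\sum_i x i *~ l i) =
    \sum_i \sum_j (k i)%:~R * (l j)%:~R * polar q (x i) (x j).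
Proof.
move=> qQ; rewrite polar_sumzl //; apply: eq_bigr => i _.
rewrite polarC polar_sumzl // mulr_sumr; apply: eq_bigr => j _.
by rewrite mulrA polarC.
Qed.

(* With B the form of Gram matrix A, the coordinate t_i is B(t, y_i) for the
   i-th row y_i of the inverse of A, so that Cauchy-Schwarz gives
   t_i ^ 2 <= B(t, t) B(y_i, y_i). *)
Lemma gram_coercive n (a : 'I_n -> 'I_n -> R) :
  (forall i j, a i j = a j i) ->
  (forall t : 'I_n -> R, (exists i, t i != 0) ->
    0 < \sum_i \sum_j t i * t j * a i j) ->
  exists2 lam, 0 < lam & forall t : 'I_n -> R,
    lam * (\sum_i t i ^+ 2) <= \sum_i \sum_j t i * t j * a i j.
Proof.
move=> aC a_pos; pose A : 'M[R]_n := \matrix_(i, j) a i j.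
pose form (u v : 'rV[R]_n) := (u *m A *m v^T) 0 0.
have formE (u : 'rV[R]_n) : form u u = \sum_i \sum_j u 0 i * u 0 j * a i j.
  rewrite /form mxE exchange_big; apply: eq_bigr => j _ /=.
  rewrite !mxE mulr_suml; apply: eq_bigr => i _.
  by rewrite !mxE; ring.
have form_gt0 u : u != 0 -> 0 < form u u.
  by move=> /rV0Pn u_neq0; rewrite formE; exact: a_pos.
have form_ge0 u : 0 <= form u u.
  have [->|/form_gt0/ltW //] := eqVneq u 0.
  by rewrite /form !mul0mx mxE.
have formC u v : form u v = form v u.
  have AT : A^T = A by apply/matrixP => i j; rewrite !mxE aC.
  by rewrite /form -[u *m A *m v^T]trmxK mxE !trmx_mul trmxK AT mulmxA.
have form_combl (u v w : 'rV[R]_n) (s r : R) :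
    form (s *: u - r *: v) w = s * form u w - r * form v w.
  by rewrite /form !mulmxBl -!scalemxAl !mxE.
have form_comb (u v : 'rV[R]_n) (s r : R) :
    form (s *: u - r *: v) (s *: u - r *: v) =
    s ^+ 2 * form u u - 2 * s * r * form u v + r ^+ 2 * form v v.
  rewrite form_combl ![form _ (_ - _)]formC !form_combl (formC v u).
  by ring.
have cauchy_schwarz u v : form u v ^+ 2 <= form u u * form v v.
  have [->|/form_gt0 v_gt0] := eqVneq v 0.
    by rewrite /form trmx0 !mulmx0 !mxE expr0n mulr0.
  rewrite -subr_ge0 -(pmulr_rge0 _ v_gt0).
  (* The form at this vector equals [form v v] times the difference of the two sides of the
     inequality. *)
  have := form_ge0 (form v v *: u - form u v *: v); rewrite form_comb.
  by congr (0 <= _); ring.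
have A_unit : A \in unitmx.
  rewrite -row_free_unit -kermx_eq0; apply: contraT => /rowV0Pn[u].
  by move=> /sub_kermxP uA /form_gt0; rewrite /form uA mul0mx mxE ltxx.
pose y i := (col i (invmx A))^T.
have coordE (u : 'rV[R]_n) i : u 0 i = form u (y i).
  by rewrite /form trmxK colE mulmxA mulmxK // -colE mxE.
(* Summing the Cauchy-Schwarz bounds over the coordinates gives this constant; the added 1 keeps the
   denominator positive even for [n = 0]. *)
exists ((1 + \sum_i form (y i) (y i))^-1).
  by rewrite invr_gt0 ltr_pwDl // sumr_ge0.
move=> t; pose u : 'rV[R]_n := \row_i t i.
rewrite ler_pdivrMl ?ltr_pwDl ?sumr_ge0 //.
have -> : \sum_i \sum_j t i * t j * a i j = form u u.
  rewrite formE; apply: eq_bigr => i _; apply: eq_bigr => j _.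
  by rewrite !mxE.
rewrite mulrDl mul1r mulr_suml -[leLHS]add0r lerD // ler_sum // => i _.
by rewrite mulrC; have := cauchy_schwarz u (y i); rewrite -coordE mxE.
Qed.

Lemma positive_definite_coercive (G : zmodType) (q : G -> R) n
    (x : 'I_n -> zmodule G) :
  positive_definite q -> lin_indep x ->
  exists2 lam, 0 < lam & forall k : 'I_n -> int,
    lam * (\sum_i (k i)%:~R ^+ 2) <= q (\sum_i x i *~ k i).
Proof.
move=> [qQ q_pos] x_ind.
have [i j|lam lam_gt0 le_q] := gram_coercive _ (q_pos _ _ x_ind).
  exact: polarC.
(* The Gram matrix is that of [polar], which is 2 [q] on the diagonal. *)
exists (lam / 2) => [|k]; first by rewrite divr_gt0.
have := le_q (fun i => (k i)%:~R); rewrite -polar_sumz // polar_diag //.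
by rewrite mulrAC ler_pdivrMr // [leRHS]mulrC.
Qed.

Lemma quadratic_form_le (G : zmodType) (q : G -> R) n (x : 'I_n -> G) :
  quadratic_form q ->
  exists2 C, 0 <= C & forall k : 'I_n -> int,
    q (\sum_i x i *~ k i) <= C * (\sum_i `|(k i)%:~R|) ^+ 2.
Proof.
move=> qQ; pose C := \sum_i \sum_j `|polar q (x i) (x j)|.
have C_ge i j : `|polar q (x i) (x j)| <= C.
  rewrite /C (bigD1 i) //= (bigD1 j) //= -addrA lerDl addr_ge0 //.
    by rewrite sumr_ge0.
  by rewrite sumr_ge0 // => i' _; rewrite sumr_ge0.
have C_ge0 : 0 <= C by rewrite sumr_ge0 // => i _; rewrite sumr_ge0.
clearbody C; exists (C / 2) => [|k]; first by rewrite divr_ge0.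
rewrite mulrAC ler_pdivlMr // mulrC -polar_diag // polar_sumz //.
rewrite expr2 mulr_suml mulr_sumr ler_sum // => i _.
rewrite mulrCA 2!mulr_sumr ler_sum // => j _.
rewrite (le_trans (ler_norm _)) // !normrM [C * _]mulrC mulrA.
by rewrite ler_wpM2l // mulr_ge0.
Qed.

End QuadraticForm.

(** * Decay of coefficients *)

Section RealBounds.
Context (R : realType).

Lemma exprn_le_expR (x : R) N : 0 <= x -> x ^+ N <= N`!%:R * expR x.
Proof.
move=> x_ge0; case: N => [|N]; first by rewrite expr0 mul1r (le_trans _ (expR_ge1Dx x)) // lerDl.
rewrite mulrC -ler_pdivrMr ?ltr0n ?fact_gt0 //.
by apply: le_trans (expR_ge1Dxn N x_ge0); rewrite lerDr.
Qed.

(** Completing the square in each coordinate leaves a spare factor exp(- \sum_i |k_i|), which beats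
    the polynomial because x^N <= N! exp x. *)
Lemma gaussian_decay n (c : 'I_n -> R) lam N : 0 < lam ->
  exists2 D, 0 <= D & forall k : 'I_n -> R,
    expR (\sum_i k i * c i - lam * \sum_i k i ^+ 2)
      * (1 + \sum_i `|k i|) ^+ N <= D.
Proof.
(* [d i] is the maximum over t of (|c_i| + 1) t - lam t^2; the added 1 creates the spare decay. *)
move=> lam_gt0; pose d i := (`|c i| + 1) ^+ 2 / (4 * lam).
exists (N`!%:R * expR (1 + \sum_i d i)) => [|k].
  by rewrite mulr_ge0 ?expR_ge0.
have sum_le : \sum_i k i * c i - lam * \sum_i k i ^+ 2 <=
    \sum_i d i - \sum_i `|k i|.
  rewrite mulr_sumr -!sumrB ler_sum // => i _.
  have kc : k i * c i <= `|k i| * `|c i| by rewrite -normrM ler_norm.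
  rewrite -(real_normK (num_real (k i))) -subr_ge0.
  have -> : d i - `|k i| - (k i * c i - lam * `|k i| ^+ 2) =
      (`|k i| * `|c i| - k i * c i)
      + (2 * lam * `|k i| - (`|c i| + 1)) ^+ 2 / (4 * lam).
    by rewrite /d; field; rewrite lt0r_neq0.
  by rewrite addr_ge0 ?subr_ge0 // divr_ge0 ?sqr_ge0 // mulr_ge0 // ltW.
set T := \sum_i `|k i| in sum_le *.
have T_ge0 : 0 <= T by rewrite sumr_ge0.
apply: (@le_trans _ _ (expR (\sum_i d i - T) * (N`!%:R * expR (1 + T)))).
  by rewrite ler_pM ?expR_ge0 ?exprn_ge0 ?addr_ge0 // ?ler_expR ?exprn_le_expR //
     addr_ge0.
rewrite mulrCA ler_wpM2l // -expRD le_eqVlt; apply/orP; left; apply/eqP.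
by congr expR; ring.
Qed.

Lemma ln_continuous_at (y delta : R) : 0 < y -> 0 < delta ->
  exists2 eps, 0 < eps &
    forall z, `|z - y| < eps -> `|ln z - ln y| < delta.
Proof.
(* This radius is the distance from y to y exp(-delta); y exp(delta) is at least as far, since
   exp(delta) + exp(-delta) >= 2. *)
move=> y_gt0 delta_gt0; exists (y * (1 - expR (- delta))).
  by rewrite mulr_gt0 // subr_gt0 expR_lt1 oppr_lt0.
move=> z; rewrite ltr_distl => /andP[z_gt z_lt].
have {}z_gt : y * expR (- delta) < z by apply: le_lt_trans z_gt; lra.
have z_gt0 : 0 < z by apply: lt_trans z_gt; rewrite mulr_gt0 // expR_gt0.
have {}z_lt : z < y * expR delta.
  apply: lt_le_trans z_lt _; rewrite -[X in X + _]mulr1 -mulrDr ler_pM2l //.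
  have := expR_ge1Dx delta; have := expR_ge1Dx (- delta); lra.
rewrite ltr_distl; apply/andP; split.
  by rewrite -ltr_expR expRD !lnK ?posrE.
by rewrite -ltr_expR expRD !lnK ?posrE.
Qed.

Lemma sum_sqr_intr_le0 n (k : 'I_n -> int) :
  \sum_i (k i)%:~R ^+ 2 <= 0 :> R -> forall i, k i = 0.
Proof.
have sqr_ge0 i : 0 <= (k i)%:~R ^+ 2 :> R by exact: sqr_ge0.
move=> sum_le0 i; have sum0 : \sum_i (k i)%:~R ^+ 2 = 0 :> R.
  by apply/le_anti; rewrite sum_le0 sumr_ge0.
have /(_ i isT)/eqP := psumr_eq0P (fun j _ => sqr_ge0 j) sum0.
by rewrite sqrf_eq0 intr_eq0 => /eqP.
Qed.

End RealBounds.

(** * Absolute values of theta coefficients, and analyticity *)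

Section AbsoluteValue.
Context (R : realType) (K : fieldType) (nm : K -> R).
Hypothesis nmP : absolute_value nm.

Lemma absval_gt0 x : x != 0 -> 0 < nm x.
Proof.
have [nm_ge0 nm0 _ _] := nmP => x_neq0.
by rewrite lt0r nm_ge0 andbT; apply: contra x_neq0 => /eqP/nm0 ->.
Qed.

Lemma absval1 : nm 1 = 1.
Proof.
have [_ _ nmM _] := nmP; have /absval_gt0/lt0r_neq0 := oner_neq0 K.
by move=> /mulfI; apply; rewrite -nmM !mulr1.
Qed.

Lemma ln_absvalM x y : x != 0 -> y != 0 ->
  ln (nm (x * y)) = ln (nm x) + ln (nm y).
Proof.
have [_ _ nmM _] := nmP.
by move=> x_neq0 y_neq0; rewrite nmM lnM // posrE absval_gt0.
Qed.

Lemma ln_absvalV x : x != 0 -> ln (nm x^-1) = - ln (nm x).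
Proof.
move=> x_neq0; apply: (addrI (ln (nm x))).
by rewrite -ln_absvalM ?invr_eq0 // mulfV // absval1 ln1 subrr.
Qed.

Lemma absval_dist x y : `|nm x - nm y| <= nm (x - y).
Proof.
have [nm_ge0 _ nmM nmD] := nmP.
have nmN1 : nm (-1) = 1.
  have /eqP : nm (-1) ^+ 2 = 1 by rewrite expr2 -nmM mulrNN mulr1 absval1.
  by rewrite sqrf_eq1 => /orP[/eqP //|/eqP nmN1]; have := nm_ge0 (-1); lra.
have := nmD (x - y) y; have := nmD (-1 * (x - y)) x.
rewrite nmM nmN1 mulN1r opprB !subrK => yx xy.
by rewrite ler_distl; lra.
Qed.

Context (H : zmodType) (alpha : H -> H -> K).
Hypothesis alphaP : quantization_parameter alpha.
Context (P : pred (torus_points H K)) (B : subZmodType P).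
Variable L : theta_multiplier alpha B.
Local Notation hl := (theta_hl L).
Local Notation hr := (theta_hr L).
Local Notation hm := (theta_hminus L).
Implicit Types (b c : B) (g : H).

Let alpha_neq0 := quant_neq0 alphaP.
Let psi_neq0 := theta_psi_neq0 L.
Let pairing_neq0 := theta_pairing_neq0 L.
Let value_neq0 b g : period_value b g != 0 := period_value_neq0 b g.

(** Logarithms turn alpha into a real alternating biadditive form, which removes the signs alpha(h,
    h) = +- 1. *)
Let A h g := ln (nm (alpha h g)).

Let ADl h1 h2 g : A (h1 + h2) g = A h1 g + A h2 g.
Proof. by rewrite /A (quantDl alphaP) ln_absvalM. Qed.
Let ANr h g : A h (- g) = - A h g.
Proof. by rewrite /A (quantNr alphaP) ln_absvalV. Qed.
Let ADr h g1 g2 : A h (g1 + g2) = A h g1 + A h g2.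
Proof. by rewrite /A (quantDr alphaP) ln_absvalM. Qed.
Let AC h g : A h g = - A g h.
Proof. by rewrite /A (quant_skew alphaP) ln_absvalV. Qed.
Let A_diag h : A h h = 0.
Proof. by have := AC h h; lra. Qed.

Let ln_period_value_hminus b c :
  ln (nm (period_value b (hm c))) =
    2 * ln (nm (theta_pairing L b c)) + A (hl b) (hl c) - A (hr b) (hr c).
Proof.
rewrite [period_value _ _]theta_compat expr2.
rewrite !ln_absvalM ?mulf_neq0 ?invr_eq0 // ln_absvalV // -!/(A _ _).
by ring.
Qed.

Let theta_formE b :
  theta_form nm L b = ln (nm (theta_pairing L b b)) + A (hl b) (hr b).
Proof.
by rewrite /theta_form ln_absvalM ?invr_eq0 // ln_absvalV // -/(A _ _) ANr opprK.
Qed.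

(** The part of log |c_b(g + h^-_b)| that is additive in [b]. *)
Definition theta_drift g b : R :=
  ln (nm (theta_psi L b)) + ln (nm (alpha (hl b + hr b) g))
    - ln (nm (period_value b g)).

Lemma theta_driftD g b c :
  theta_drift g (b + c) = theta_drift g b + theta_drift g c.
Proof.
rewrite /theta_drift theta_psiD period_valueDl (raddfD hl) (raddfD hr).
rewrite !ln_absvalM // -!/(A _ _) !ADl.
by ring.
Qed.

(** The quadratic part is log |(b, b)| - A(h_l, h_r) - log |b(h^-_b)|, where the last logarithm is 2
    log |(b, b)| because [A] is alternating. *)
Lemma ln_theta_factor g b :
  ln (nm (theta_factor L b (g + hm b))) = theta_drift g b - theta_form nm L b.
Proof.
rewrite /theta_factor period_valueDr !ln_absvalM ?invr_eq0 ?mulf_neq0 //.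
rewrite ln_absvalV ?mulf_neq0 // ln_absvalM // ln_period_value_hminus.
rewrite theta_formE /theta_drift -!/(A _ _) /theta_hminus.
rewrite !(ADl, ADr, ANr) !A_diag (AC (hr b) (hl b)).
by ring.
Qed.

Lemma absval_theta_coef (a : formal_function H K) g b : Gamma L a ->
  nm (a (g + hm b)) = nm (a g) * expR (theta_drift g b - theta_form nm L b).
Proof.
have [_ _ nmM _] := nmP.
move=> /(GammaP alphaP)/(_ b (g + hm b)) ->; rewrite addrK nmM mulrC.
rewrite -ln_theta_factor lnK // posrE absval_gt0 //.
exact: theta_factor_neq0.
Qed.

(** When h^-_b = 0, compatibility at (b, b) forces |(b, b)| = 1, and h_(b,l) = h_(b,r) kills the
    alpha term. *)
Lemma theta_form_ker b : hm b = 0 -> theta_form nm L b = 0.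
Proof.
move=> hmb0; have := ln_period_value_hminus b b.
rewrite theta_formE hmb0 /period_value char0 absval1 ln1 !A_diag.
have -> : hr b = hl b by apply/esym/eqP; rewrite -subr_eq0; apply/eqP.
by rewrite A_diag; lra.
Qed.

(** A relation between the images gives an element of the kernel of h^-, where the form vanishes;
    coercivity then makes all coefficients zero. *)
Lemma lin_indep_hminus n (v : 'I_n -> zmodule B) :
  positive_definite (theta_form nm L) -> lin_indep v ->
  lin_indep (fun i => hm (v i) : zmodule H).
Proof.
move=> q_pd v_ind c c0.
have [lam lam_gt0 /(_ c)] := positive_definite_coercive q_pd v_ind.
rewrite theta_form_ker; last first.
  rewrite -[RHS]c0 raddf_sum; apply: eq_bigr => i _.
  by rewrite raddfMz.
by rewrite pmulr_rle0 // => /sum_sqr_intr_le0.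
Qed.

Lemma theta_analytic n (a : formal_function H K) :
  free_of_rank H n -> finite_index (range hm) ->
  positive_definite (theta_form nm L) -> Gamma L a -> analytic nm a.
Proof.
move=> /has_dimP[h [_ h_ind h_gen]] hm_fin q_pd aG nu [q' [q'Q _] nuE].
have [m /choice[b hmb]] :=
  common_exponent (fun i => finite_index_exponent (h i) hm_fin).
have b_ind := lin_indep_multiple h_ind hmb.
have [lam lam_gt0 q_ge] := positive_definite_coercive q_pd b_ind.
have [C C_ge0 q'_le] := quadratic_form_le h q'Q.
have nu_ge0 g : 0 <= nu g by rewrite nuE sqrtr_ge0.
have [nm_ge0 _ _ _] := nmP.
pose G0 (r : {ffun 'I_n -> 'I_m.+1}) := \sum_i h i *+ r i.
have nu_le : exists2 C', 0 <= C' &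
    forall r (k : 'I_n -> int), nu (G0 r + hm (\sum_i b i *~ k i)) <=
      C' * (1 + \sum_i `|(k i)%:~R|).
  (* Each coordinate r_i + (m + 1) k_i is at most (m + 1) (1 + |k_i|) in absolute value; these
     bounds are summed over [i]. *)
  exists (Num.sqrt C * (m.+1%:R * n.+1%:R)) => [|r k].
    by rewrite !mulr_ge0 ?sqrtr_ge0.
  have -> : G0 r + hm (\sum_i b i *~ k i) =
      \sum_i h i *~ ((r i : nat)%:Z + m.+1%:Z * k i).
    rewrite raddf_sum -big_split; apply: eq_bigr => i _ /=.
    by rewrite raddfMz hmb mulrzDr mulrzA !pmulrn.
  rewrite nuE (le_trans (ler_wsqrtr (q'_le _))) // sqrtrM // sqrtr_sqr.
  rewrite -mulrA ler_wpM2l ?sqrtr_ge0 // ger0_norm ?sumr_ge0 //.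
  apply: (@le_trans _ _ (\sum_(i < n) (m.+1%:R + m.+1%:R * `|(k i)%:~R|))).
    rewrite ler_sum // => i _; rewrite rmorphD rmorphM (le_trans (ler_normD _ _)) //.
    rewrite lerD //; last by rewrite normrM ger0_norm.
    by rewrite ger0_norm // ler_nat ltnW.
  rewrite big_split /= sumr_const card_ord -mulr_sumr -[X in X + _]mulr_natr.
  rewrite -mulrDr -mulrA.
  rewrite ler_wpM2l // mulrDr mulr1 lerD ?ler_nat //.
  by rewrite ler_peMl ?sumr_ge0 // ler1n.
have bound_r N r : exists2 D, 0 <= D & forall k : 'I_n -> int,
    let g := G0 r + hm (\sum_i b i *~ k i) in nm (a g) * nu g ^+ N <= D.
  have [C' C'_ge0 {}nu_le] := nu_le.
  have [D D_ge0 D_bound] :=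
    gaussian_decay (fun i => theta_drift (G0 r) (b i)) N lam_gt0.
  exists (nm (a (G0 r)) * C' ^+ N * D) => [|k /=].
    by rewrite !mulr_ge0 ?exprn_ge0.
  rewrite absval_theta_coef //; set x := \sum_i b i *~ k i.
  have -> : theta_drift (G0 r) x =
      \sum_i (k i)%:~R * theta_drift (G0 r) (b i).
    by apply: additive_sumz; exact: theta_driftD.
  rewrite -!mulrA ler_wpM2l //.
  have := D_bound (fun i => (k i)%:~R).
  move=> /(ler_wpM2l (exprn_ge0 N C'_ge0)); apply: le_trans.
  rewrite mulrCA -exprMn ler_pM ?expR_ge0 ?exprn_ge0 //.
    by rewrite ler_expR lerB.
  by rewrite lerXn2r ?nnegrE ?nu_ge0 ?nu_le // mulr_ge0 ?addr_ge0 ?sumr_ge0.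
have bound N : exists2 D, 0 <= D & forall g, nm (a g) * nu g ^+ N <= D.
  have /choice[D D_bound] : forall r, exists D, 0 <= D /\ forall k : 'I_n -> int,
    let g := G0 r + hm (\sum_i b i *~ k i) in nm (a g) * nu g ^+ N <= D.
    by move=> r; have [D] := bound_r N r; exists D.
  exists (\sum_r D r) => [|g]; first by apply: sumr_ge0 => r _; case: (D_bound r).
  have [k ->] := h_gen g I.
  have [r [l ->]] := coset_decomposition k hmb.
  apply: (le_trans ((D_bound r).2 l)); rewrite (bigD1 r) //= lerDl.
  by apply: sumr_ge0 => r' _; case: (D_bound r').
(* The bound for the exponent [N.+1] gives |a_g| nu(g)^N <= D / nu(g), which is below [eps] once
   nu(g) > D / eps. *)
move=> N eps eps_gt0; have [D D_ge0 D_bound] := bound N.+1.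
exists (D / eps) => g nu_gt; have nu_gt0 : 0 < nu g.
  by apply: le_lt_trans nu_gt; rewrite divr_ge0 // ltW.
rewrite -(ltr_pM2r nu_gt0); have := D_bound g.
rewrite exprSr mulrA => /le_lt_trans; apply.
by rewrite mulrC -ltr_pdivrMr.
Qed.

End AbsoluteValue.

(** * Unitary quantization parameter *)

(** Freeness supplies a basis of unknown size; the bound on independent families makes it finite and
    the family [b] fixes its size. *)
Lemma free_bounded_rank (G : zmodType) n (b : 'I_n -> zmodule G) :
  is_free G -> lin_indep b ->
  (forall k (v : 'I_k -> zmodule G), lin_indep v -> (k <= n)%N) ->
  free_of_rank G n.
Proof.
move=> [S S_basis] b_ind le_n; have [_ S_ind _] := S_basis.
have : finite_set S.
  apply: contrapT => /(@infinite_set_ord _ _ n.+1)[v v_inj Sv].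
  by have /le_n := S_ind _ _ v_inj Sv; rewrite ltnn.
move=> /finite_setP[d Sd]; have dimG : free_of_rank G d by exists S.
have [v [_ v_ind _]] := (has_dimP _ _).1 dimG.
suff -> : n = d by [].
apply/anti_leq; rewrite (le_n _ _ v_ind) andbT.
exact: (lin_indep_leq_dim (v := b) dimG).
Qed.

Section Unitary.
Context (R : realType) (K : fieldType) (nm : K -> R).
Hypothesis nmP : absolute_value nm.
Context (H : zmodType) (alpha : H -> H -> K).
Hypothesis alphaP : quantization_parameter alpha.
Hypothesis alpha_unitary : forall h g, nm (alpha h g) = 1.
Context (P : pred (torus_points H K)) (B : subZmodType P).
Variable L : theta_multiplier alpha B.
Local Notation hm := (theta_hminus L).

Lemma theta_form_unitary :
  theta_form nm L = (fun b => ln (nm (theta_pairing L b b))).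
Proof.
apply/funext => b; rewrite /theta_form ln_absvalM ?invr_eq0 //.
- by rewrite ln_absvalV ?(quant_neq0 alphaP) // alpha_unitary ln1 oppr0 addr0.
- exact: theta_pairing_neq0.
- exact: quant_neq0 alphaP _ _.
Qed.

(** For unitary alpha, compatibility says |b(h^-_c)| = |(b, c)|^2, so the form controls the topology
    of the torus on periods. *)
Lemma polar_theta_form b c :
  polar (theta_form nm L) b c = ln (nm (period_value b (hm c))).
Proof.
have pairing_neq0 := theta_pairing_neq0 L.
rewrite theta_form_unitary /polar [period_value _ _]theta_compat.
rewrite !theta_pairingDl !(theta_pairingC L _ (b + c)) !theta_pairingDl.
rewrite (theta_pairingC L c b) expr2.
rewrite !(ln_absvalM nmP) ?mulf_neq0 ?invr_eq0 ?(quant_neq0 alphaP) //.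
rewrite (ln_absvalV nmP) ?(quant_neq0 alphaP) // !alpha_unitary ln1.
by ring.
Qed.

(** Preimages of multiples of a basis of [H] give [n] independent periods, and h^- sends independent
    periods to independent elements of [H]. *)
Lemma free_rank_period_group n :
  free_of_rank H n -> is_free B -> finite_index (range hm) ->
  positive_definite (theta_form nm L) -> free_of_rank B n.
Proof.
move=> H_free B_free hm_fin q_pd.
have [h [_ h_ind _]] := (has_dimP _ _).1 H_free.
have [m /choice[b hmb]] :=
  common_exponent (fun i => finite_index_exponent (h i) hm_fin).
apply: (free_bounded_rank B_free (lin_indep_multiple h_ind hmb)) => k v v_ind.
apply: (lin_indep_leq_dim H_free) (lin_indep_hminus nmP alphaP q_pd v_ind).
by [].
Qed.

Lemma finite_index_hminus n :
  free_of_rank H n -> free_of_rank B n ->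
  positive_definite (theta_form nm L) -> finite_index (range hm).
Proof.
move=> H_free /has_dimP[v [_ v_ind _]] q_pd.
apply: full_rank_finite_index H_free (lin_indep_hminus nmP alphaP q_pd v_ind) _.
by move=> i; exists (v i).
Qed.

(* If c is close to b at the points h^-_(v_j), v a basis of B, then
   k = c - b has polar(k, v_j) < lam for all j, hence
   2 lam |k| ^ 2 <= polar(k, k) < lam \sum_j |k_j| <= lam |k| ^ 2
   unless k = 0, the coordinates k_j being integers. *)
Lemma discrete_period_group n :
  free_of_rank B n -> positive_definite (theta_form nm L) ->
  discrete_in_torus nm B.
Proof.
move=> /has_dimP[v [_ v_ind v_gen]] q_pd b.
have q_quad := q_pd.1.
have [lam lam_gt0 q_ge] := positive_definite_coercive q_pd v_ind.
have value_gt0 (c : B) j : 0 < nm (period_value c (hm (v j))).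
  by rewrite absval_gt0 ?period_value_neq0.
have /choice[eps epsP] : forall j, exists eps, 0 < eps /\
    forall z, `|z - nm (period_value b (hm (v j)))| < eps ->
      `|ln z - ln (nm (period_value b (hm (v j))))| < lam.
  move=> j; have [eps eps_gt0 epsP] := ln_continuous_at (value_gt0 b j) lam_gt0.
  by exists eps.
(* The default 1 of the minimum keeps the radius positive when [n = 0]. *)
exists [seq hm (v j) | j <- enum 'I_n], (\big[Num.min/1]_j eps j); split.
  by apply: lt_bigmin => // j _; have [] := epsP j.
move=> c c_near; have [k cbE] := v_gen (c - b) I.
have polar_lt j : `|polar (theta_form nm L) (c - b) (v j)| < lam.
  have -> : polar (theta_form nm L) (c - b) (v j) =
      ln (nm (period_value c (hm (v j)))) - ln (nm (period_value b (hm (v j)))).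
    by rewrite -!polar_theta_form -{2}(subrK b c) q_quad.2 addrK.
  apply: (epsP j).2; apply: le_lt_trans (absval_dist nmP _ _) _.
  apply: lt_le_trans (_ : _ < \big[Num.min/1]_j eps j) _.
    by apply: c_near; apply/mapP; exists j; rewrite ?mem_enum.
  exact: bigmin_le_cond.
have sum_le : \sum_j `|(k j)%:~R| <= \sum_j (k j)%:~R ^+ 2 :> R.
  rewrite ler_sum // => j _; rewrite -real_normK ?num_real // expr2.
  have [->|kj_neq0] := eqVneq (k j) 0; first by rewrite normr0 mul0r.
  by rewrite ler_peMr // norm_intr_ge1 // intr_eq0.
have q_le : 2 * theta_form nm L (c - b) <= lam * \sum_j `|(k j)%:~R|.
  rewrite -polar_diag // {1}cbE polar_sumzl // mulr_sumr ler_sum // => j _.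
  apply: le_trans (ler_norm _) _; rewrite normrM mulrC ler_wpM2r //.
  by rewrite polarC ltW.
have k0 : forall j, k j = 0.
  apply: (@sum_sqr_intr_le0 R); rewrite -(pmulr_rle0 _ lam_gt0).
  have := q_ge k; rewrite -/(\sum_i k i *: v i) -cbE => {}q_ge.
  by have := ler_wpM2l (ltW lam_gt0) sum_le; lra.
by apply/eqP; rewrite -subr_eq0 cbE big1 // => j _; rewrite k0 scale0r.
Qed.

End Unitary.

Theorem theorem2p6p1
    (K : fieldType)
    (H : zmodType) (n : nat) (H_free : free_of_rank H n)
    (alpha : H -> H -> K) (alphaP : quantization_parameter alpha)
    (P : pred (torus_points H K)) (B : subZmodType P)
    (L : theta_multiplier alpha B) :
  (injective (theta_hminus L) ->
   forall d : nat,
     has_dim (Gamma L) d <-> has_index (range (theta_hminus L)) d)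
  /\
  (forall (R : realType) (nm : K -> R), absolute_value nm ->
     (finite_index (range (theta_hminus L)) ->
      positive_definite (theta_form nm L) ->
      forall theta, Gamma L theta -> analytic nm theta)
     /\
     (is_free B ->
      (forall h h' : H, nm (alpha h h') = 1) ->
      (finite_index (range (theta_hminus L)) /\
       positive_definite (theta_form nm L))
      <->
      [/\ free_of_rank B n,
          discrete_in_torus nm B
        & positive_definite (fun b : B => ln (nm (theta_pairing L b b)))])).
Proof.
split=> [hm_inj d|R nm nmP]; first exact: has_dim_Gamma.
split=> [hm_fin q_pd theta thetaG|B_free alpha_unitary].
  exact: (theta_analytic nmP alphaP H_free hm_fin q_pd thetaG).
(* Both sides now assert positivity of the same form; what remains is to relate the index to the
   rank and to discreteness. *)
rewrite -(theta_form_unitary nmP alphaP alpha_unitary L).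
split=> [[hm_fin q_pd]|[B_rank _ q_pd]].
  have B_rank := free_rank_period_group nmP alphaP H_free B_free hm_fin q_pd.
  split=> //.
  exact: (discrete_period_group nmP alphaP alpha_unitary B_rank q_pd).
by split=> //; exact: (finite_index_hminus nmP alphaP H_free B_rank q_pd).
Qed.
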